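(* There is an absolute constant $C>0$ such that the following holds. Let $\mu$ be a locally finite Borel measure on $\mathbb{R}^d$, let $T$ be a martingale transform, and let $F_0\in\mathcal{D}$ be a dyadic cube. Assume that $f:\mathbb{R}^d\to\mathbb{R}$ is a locally integrable (with respect to $\mu$) function that is supported on the cube $F_0$. Then there exists a sparse collection $\mathcal{F}$ of dyadic subcubes of $F_0$ such that $$ |Tf|\,1_{F_0}\le C\,\big(\|T\|_{L^1\to L^{1,\infty}}+1\big) \Big(\sum_{F\in\mathcal{F}} \langle |f|\rangle_F 1_F +\sum_{F\in\mathcal{F}} \langle |f|\rangle_{\hat{F}}1_F\Big) $$ $\mu$-almost everywhere.
   Context: $\mathcal{D}$ denotes the collection of dyadic cubes of $\mathbb{R}^d$; $\hat{Q}$ is the dyadic parent of $Q\in\mathcal{D}$, and $\mathrm{ch}_{\mathcal{D}}(Q)=\{Q'\in\mathcal{D}:\hat{Q'}=Q\}$ is the collection of its dyadic children. Averages are $\langle f\rangle_Q:=\frac{1}{\mu(Q)}\int_Q f\,d\mu$ (interpreted as $0$ if $\mu(Q)=0$), and $L^1=L^1(\mu)$, $L^{1,\infty}=L^{1,\infty}(\mu)$. The martingale transform $T$ associated with constant coefficients $(\epsilon_Q)_{Q\in\mathcal{D}}$ satisfying $|\epsilon_Q|\le 1$ is $$Tf:=\sum_{Q\in\mathcal{D}}\epsilon_Q D_Qf,\qquad D_Qf:=\sum_{Q'\in \mathrm{ch}_{\mathcal{D}}(Q)}\langle f\rangle_{Q'}1_{Q'}-\langle f\rangle_Q 1_Q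 .$$ For a collection $\mathcal{F}\subseteq\mathcal{D}$ and a cube $F$, $\mathrm{ch}_{\mathcal{F}}(F)$ denotes the collection of all maximal cubes $F'\in\mathcal{F}$ such that $F'\subsetneq F$. The collection $\mathcal{F}$ is called sparse (with respect to $\mu$) if there exists $\gamma\in(0,1)$ such that $\sum_{F'\in \mathrm{ch}_{\mathcal{F}}(F)}\mu(F')\le\gamma\,\mu(F)$ for every $F\in\mathcal{F}$. *)

(* Defs.v *)
From HB Require Import structures.
From mathcomp Require Import all_boot all_order all_algebra.
From mathcomp Require Import all_classical all_reals all_analysis.

Set Implicit Arguments.
Unset Strict Implicit.
Unset Printing Implicit Defensive.

Import Order.TTheory GRing.Theory Num.Theory.
Import numFieldNormedType.Exports.

Local Open Scope classical_set_scope.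
Local Open Scope ring_scope.

(* R^d with its Borel sigma-algebra. *)
Notation borelR R d := (g_sigma_algebraType (@open 'rV[R]_d)).

(* The dyadic cube of generation k (side length 2^-k) at position m is encoded
   by (k, m).  For d > 0 the encoding is injective; for d = 0 it is not. *)
Notation dyadic d := (int * {ffun 'I_d -> int})%type.

Section cubes.
Context {d : nat}.
Implicit Types (Q F : dyadic d) (FF : set (dyadic d)).

Definition cube (R : realType) Q : set 'rV[R]_d :=
  [set x | forall i, (Q.2 i)%:~R * 2 ^ (- Q.1) <= x ord0 i
                     < (Q.2 i + 1)%:~R * 2 ^ (- Q.1)].

Arguments cube R Q : clear implicits.

Definition parent Q : dyadic d := (Q.1 - 1, [ffun i => (Q.2 i %/ 2)%Z]).

Definition children Q : set (dyadic d) := [set Q' | parent Q' = Q].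

Definition maxchildren (R : realType) FF F : set (dyadic d) :=
  [set F' | [/\ FF F', cube R F' `<` cube R F &
    forall G, FF G -> cube R G `<` cube R F ->
      cube R F' `<=` cube R G -> G = F']].

End cubes.

Arguments cube {d} R Q.
Arguments maxchildren {d} R FF F _.

Section martingale_transform.
Context {R : realType} {d : nat}.
Variable mu : {measure set (borelR R d) -> \bar R}.
Implicit Types (Q F : dyadic d) (f g : 'rV[R]_d -> R) (x : 'rV[R]_d).

Definition locally_finite : Prop :=
  forall x, exists2 U : set 'rV[R]_d, open_nbhs x U & (mu U < +oo)%E.

Definition loc_integrable f : Prop :=
  measurable_fun [set: borelR R d] (f : borelR R d -> R) /\
  forall K : set 'rV[R]_d, compact K -> mu.-integrable K (EFin \o f).

(* Since 0^-1 = 0, this is 0 when mu (cube R Q) = 0. *)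
Definition avg f Q : R :=
  Rintegral mu (cube R Q) f / fine (mu (cube R Q)).

Definition mdiff f Q x : R :=
  \sum_(Q' \in children Q) avg f Q' * \1_(cube R Q') x
  - avg f Q * \1_(cube R Q) x.

(* The sum over all cubes is the limit of the sums over generations -n, ..., n.
   At each point only one cube per generation contributes, so these are finite
   sums.  For integrable f they converge mu-almost everywhere (absolutely on the
   coarse side, by martingale convergence on the fine side). *)
Definition martingale_transform (eps : dyadic d -> R) f x : R :=
  limn (fun n : nat =>
    \sum_(Q \in [set Q : dyadic d | (`|Q.1| <= n)%N]) eps Q * mdiff f Q x).

Definition L1_norm f : \bar R := (\int[mu]_x `|f x|%:E)%E.

Definition weakL1_norm g : \bar R :=
  ereal_sup [set (l%:E * mu [set x | (l < `|g x|)%R])%E | l in [set l : R | 0 < l]].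

(* The least admissible constant, +oo if there is none. *)
Definition L1_weakL1_opnorm (T : ('rV[R]_d -> R) -> 'rV[R]_d -> R) : \bar R :=
  ereal_inf [set c%:E | c in [set c : R | 0 <= c /\
    forall f, mu.-integrable [set: borelR R d] (EFin \o f) ->
      (weakL1_norm (T f) <= c%:E * L1_norm f)%E]].

Definition sparse (FF : set (dyadic d)) : Prop :=
  exists gamma : R, 0 < gamma < 1 /\
    forall F, FF F ->
      (\esum_(F' in maxchildren R FF F) mu (cube R F') <= gamma%:E * mu (cube R F))%E.

End martingale_transform.

(* Main.v *)
Require Import Defs.
From HB Require Import structures.
From mathcomp Require Import all_boot all_order all_algebra.
From mathcomp Require Import all_classical all_reals all_analysis.
From mathcomp Require Import measurable_realfun finmap ring lra zify.

Import Order.TTheory GRing.Theory Num.Theory.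
Import numFieldNormedType.Exports.

Local Open Scope classical_set_scope.
Local Open Scope ring_scope.

(** The sparse family is produced by a stopping time, and the weak-type norm of T
enters through one observation: stopping a function stops its transform.

At a point x only one cube of each generation contributes, so Tf(x) is a sum over
generations k of eps_Q (<f>_Q' - <f>_Q), where Q and Q' are the cubes of generations
k and k + 1 containing x.  The generations coarser than F0 are harmless: f is
supported on F0, so there |<f>_Q| = |int f| / mu(Q) increases as Q shrinks, and the sum
telescopes to at most <|f|>_{F0} ([coarse_sum_le]).

For the remaining generations, let c0 be the weak-type norm plus 1.  Below a cube F
stop at the maximal cubes E on which <|f|>_E > 10 <|f|>_F, or on which the partial sum
L of the transform from F down to E satisfies |L| > 10 c0 <|f|>_F.
Iterating from F0 gives the family.

Sparseness ([stops_mass_le]): the cubes of the first kind have total measure at most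
mu(F) / 10.  For finitely many cubes E of the second kind, let g be f on F with f
replaced by its average on each E, minus <f>_F on F.  The differences of g vanish above F
and below each E, and agree with those of f in between, so that Tg is on E exactly the
partial sum that was stopped ([martingale_transform_stopped]).  Since
||g||_1 <= 4 int_F |f|, the weak-type inequality bounds the measure of these cubes by
4/10 mu(F) ([weak_type_stopping]).  Thus the constant 1/2 works.  In this way a bound
for T alone controls all its truncations at once, with no maximal operator.

Domination ([locsum_family_le]): follow the cubes containing x.  Just above a
stopping cube E the partial sum is still at most 10 c0 <|f|>_F, the last step
costs at most <|f|>_E + <|f|>_{parent of E}, and below E the argument restarts with E
in the role of F.  Summing gives the constant 10 c0 + 1 <= 11 c0.

All pointwise statements hold off the union of the null dyadic cubes, which is null
because there are countably many.  If the weak-type norm is infinite the family {F0}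
suffices, unless f vanishes almost everywhere, when Tf does too. *)

(** * Dyadic cubes containing a point *)

Section grid.
Context {R : realType} {d : nat}.
Implicit Types (Q F : dyadic d) (x y : 'rV[R]_d) (k : int) (m n : nat).

(** The cube of generation [k] containing [x].  Almost every statement below is phrased
along the chain [dcube k x], in which nestedness of dyadic cubes becomes the fact that
a coarser term of the chain is determined by any finer one ([dcube_le]). *)
Definition dcube k x : dyadic d := (k, [ffun i => Num.floor (x ord0 i * 2 ^ k)]).

Lemma cubeE Q x : cube R Q x <-> dcube Q.1 x = Q.
Proof.
case: Q => k q; rewrite /cube /dcube /=.
have k0 : 0 < (2 : R) ^ k by rewrite exprz_gt0.
split=> [H|[<-] i].
  congr (_, _); apply/ffunP => i; rewrite ffunE; apply: floor_def.
  move: (H i); rewrite -!invr_expz -ler_pdivlMr ?invr_gt0// invrK.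
  by rewrite ltr_pdivlMr.
rewrite ffunE -!invr_expz -ler_pdivlMr ?invr_gt0// invrK ltr_pdivlMr//.
exact: floor_itv.
Qed.

Lemma cube_dcube k x : cube R (dcube k x) x.
Proof. exact/cubeE. Qed.

Lemma parent_dcube k x : parent (dcube k x) = dcube (k - 1) x.
Proof.
congr (_, _); apply/ffunP => i; rewrite !ffunE /=.
rewrite expfzDr// -[2 ^ (-1)]/(2^-1) mulrA.
set y := (_ * 2 ^ k); set z := Num.floor y.
apply/esym/floor_def.
have /andP[zy yz] := floor_itv y; rewrite -/z in zy yz.
have z1 : (z %/ 2)%Z * 2 <= z by lia.
have z2 : z + 1 <= ((z %/ 2)%Z + 1) * 2 by lia.
have e2 (w : int) : w%:~R * 2 = (w * 2)%:~R :> R by rewrite intrM.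
rewrite ler_pdivlMr// ltr_pdivrMr// !e2; apply/andP; split.
  by apply: le_trans zy; rewrite ler_int.
by apply: lt_le_trans yz _; rewrite ler_int.
Qed.

Lemma dcube_le j k x y : j <= k -> dcube k x = dcube k y -> dcube j x = dcube j y.
Proof.
move=> jk; have -> : j = k - (absz (k - j))%:Z by lia.
elim: (absz _) => [|n IH]; first by rewrite subr0.
move=> /IH h; rewrite -addn1 PoszD opprD addrA -!parent_dcube.
by rewrite h.
Qed.

Lemma cube_dcube_sub j k x : j <= k -> cube R (dcube k x) `<=` cube R (dcube j x).
Proof. by move=> jk y /cubeE/= h; apply/cubeE; exact: dcube_le jk h. Qed.

Lemma cube_nested Q F x : F.1 <= Q.1 -> cube R Q x -> cube R F x ->
  cube R Q `<=` cube R F.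
Proof. by move=> FQ /cubeE <- /cubeE <-; exact: cube_dcube_sub. Qed.

Lemma cube_same_gen Q F x : Q.1 = F.1 -> cube R Q x -> cube R F x -> Q = F.
Proof. by move=> e /cubeE <- /cubeE <-; rewrite e. Qed.

Lemma cube_neq0 Q : exists x, cube R Q x.
Proof.
exists (\row_i ((Q.2 i)%:~R * 2 ^ (- Q.1))) => i; rewrite mxE lexx /=.
by rewrite ltr_pM2r ?exprz_gt0// ltr_int; lia.
Qed.

(** The lower corner of [Q] and the midpoint of [Q] lie in different cubes of generation
[Q.1 + 1], hence cannot share a cube finer than [Q].  This needs a coordinate, so it
fails in dimension 0. *)
Lemma cube_sub_gen (hd : (0 < d)%N) Q F : cube R Q `<=` cube R F -> F.1 <= Q.1.
Proof.
move=> QF; rewrite leNgt; apply/negP => gQF.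
pose lo : 'rV[R]_d := \row_i ((Q.2 i)%:~R * 2 ^ (- Q.1)).
pose mid : 'rV[R]_d := \row_i ((2 * Q.2 i + 1)%:~R * 2 ^ (- (Q.1 + 1))).
have e2 (w : int) : w%:~R * 2 = (w * 2)%:~R :> R by rewrite intrM.
have e : (2 : R) ^ (- Q.1) = 2 * 2 ^ (- (Q.1 + 1)).
  by rewrite -[X in X * _]expr1z -expfzDr//; congr (_ ^ _); lia.
have p : 0 < (2 : R) ^ (- (Q.1 + 1)) by rewrite exprz_gt0.
have Qlo : cube R Q lo.
  by move=> i; rewrite mxE lexx /= ltr_pM2r ?exprz_gt0// ltr_int; lia.
have Qmid : cube R Q mid.
  move=> i; rewrite mxE e !mulrA !e2 ler_pM2r// ltr_pM2r//.
  by rewrite ler_int ltr_int; lia.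
have /cubeE h1 := QF _ Qlo; have /cubeE h2 := QF _ Qmid.
have /(congr1 (fun P : dyadic d => P.2 (Ordinal hd))) :
  dcube (Q.1 + 1) lo = dcube (Q.1 + 1) mid.
  by apply: (@dcube_le _ F.1); [lia|rewrite h1 h2].
rewrite /= !ffunE !mxE e -!mulrA -expfzDr// addrC subrr expr0z !mulr1.
rewrite e2 !intrKfloor; lia.
Qed.

End grid.

(** * Cubes as Borel sets of finite measure *)

Section borel_cubes.
Context {R : realType} {d : nat}.
Implicit Types (Q F : dyadic d).

Lemma open_borel (U : set 'rV[R]_d) : open U -> measurable (U : set (borelR R d)).
Proof. by move=> oU; apply: sub_sigma_algebra. Qed.

Lemma closed_borel (U : set 'rV[R]_d) : closed U -> measurable (U : set (borelR R d)).
Proof.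
move=> cU; rewrite -[U]setCK; apply: measurableC.
by apply: open_borel; exact: closed_openC.
Qed.

Lemma measurable_cube Q : measurable (cube R Q : set (borelR R d)).
Proof.
have -> : (cube R Q : set (borelR R d)) = \bigcap_(i in [set: 'I_d])
    (((fun x : 'rV[R]_d => x ord0 i) @^-1` [set t | (Q.2 i)%:~R * 2 ^ (- Q.1) <= t]) `&`
     ((fun x : 'rV[R]_d => x ord0 i) @^-1` [set t | t < (Q.2 i + 1)%:~R * 2 ^ (- Q.1)])).
  apply/seteqP; split=> x /= h i; first by move=> _; have /andP[] := h i; split.
  by have /= [] := h i I => a b; apply/andP.
apply: fin_bigcap_measurable => // i _; apply: measurableI.
  apply: closed_borel; apply: closed_comp; last exact: closed_ge.
  by move=> x _; exact: coord_continuous.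
apply: open_borel; apply: open_comp; last exact: open_lt.
by move=> x _; exact: coord_continuous.
Qed.

Definition closed_cube Q : set 'rV[R]_d := [set x | forall i,
  `[(Q.2 i)%:~R * 2 ^ (- Q.1), (Q.2 i + 1)%:~R * 2 ^ (- Q.1)]%classic (x ord0 i)].

Lemma compact_closed_cube Q : compact (closed_cube Q).
Proof.
apply: (@rV_compact R d (fun i =>
  `[(Q.2 i)%:~R * 2 ^ (- Q.1), (Q.2 i + 1)%:~R * 2 ^ (- Q.1)]%classic)) => i.
exact: segment_compact.
Qed.

Lemma sub_closed_cube Q : cube R Q `<=` closed_cube Q.
Proof. by move=> x h i; have /andP[a b] := h i; rewrite /= in_itv/= a ltW. Qed.

Lemma measurable_closed_cube Q : measurable (closed_cube Q : set (borelR R d)).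
Proof.
apply: closed_borel; apply: compact_closed; last exact: compact_closed_cube.
exact: norm_hausdorff.
Qed.

Context (mu : {measure set (borelR R d) -> \bar R}).
Hypothesis hmu : locally_finite mu.

(** Finitely many of the neighbourhoods of finite measure cover a compact set. *)
Lemma compact_finite (K : set 'rV[R]_d) : compact K ->
  measurable (K : set (borelR R d)) -> (mu K < +oo)%E.
Proof.
move=> cK mK.
pose U x : set (borelR R d) := sval (cid2 (hmu x)).
have oU x : open_nbhs x (U x) by rewrite /U; case: cid2.
have fU x : (mu (U x) < +oo)%E by rewrite /U; case: cid2.
have mU x : measurable (U x) by apply: open_borel; case: (oU x).
move: cK; rewrite compact_cover => /(_ 'rV[R]_d setT U).
case.
- by move=> x _; case: (oU x).
- by move=> x Kx; exists x => //; case: (oU x).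
move=> D _ KD.
have h : (mu K <= \sum_(x <- D) mu (U x))%E.
  apply: (@le_trans _ _ (mu (\big[setU/set0]_(x <- D) U x))).
    apply: le_measure; rewrite ?in_setE//.
    - by apply: bigsetU_measurable => x _; exact: mU.
    - by rewrite -bigcup_fset.
  elim: (D : seq _) => [|a s IH]; first by rewrite !big_nil measure0.
  rewrite !big_cons; apply: le_trans (leeD2l _ IH).
  by apply: measureU2 => //; apply: bigsetU_measurable => x _; exact: mU.
apply: (le_lt_trans h); apply: lte_sum_pinfty => x _; exact: fU.
Qed.

Lemma cube_finite Q : (mu (cube R Q) < +oo)%E.
Proof.
apply: (@le_lt_trans _ _ (mu (closed_cube Q))); last first.
  by apply: compact_finite; [exact: compact_closed_cube|exact: measurable_closed_cube].
apply: le_measure; rewrite ?in_setE.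
- exact: measurable_cube.
- exact: measurable_closed_cube.
- exact: sub_closed_cube.
Qed.

Lemma loc_integrable_cube f Q : loc_integrable mu f ->
  mu.-integrable (cube R Q) (EFin \o f).
Proof.
move=> [_ /(_ _ (compact_closed_cube Q))]; apply: integrableS.
- exact: measurable_closed_cube.
- exact: measurable_cube.
- exact: sub_closed_cube.
Qed.

End borel_cubes.

(** * The transform as a limit over generations *)

(** A measure is monotone only on measurable sets, so the superlevel sets of a transform
must be known to be measurable, even though the defining sequence may diverge at some
points.  Convergence is characterised by equality of the (extended) limits superior and
inferior; where it fails, [limn] has the constant value 0. *)
Lemma measurable_fun_limn {dd} {T : measurableType dd} {R : realType}
    (u : (T -> R)^nat) : (forall n, measurable_fun setT (u n)) ->
  measurable_fun setT (fun x => limn (u ^~ x)).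
Proof.
move=> mu.
pose v n (x : T) : \bar R := (u n x)%:E.
have mv n : measurable_fun [set: T] (v n) by apply/measurable_EFinP.
pose s x := limn_esup (v ^~ x); pose i x := limn_einf (v ^~ x).
have ms : measurable_fun setT s by exact: measurable_fun_limn_esup.
have mi : measurable_fun setT i.
  apply: measurableT_comp => //; apply: measurable_fun_limn_esup => n.
  exact: measurableT_comp.
have cvgv x l : u ^~ x @ \oo --> l -> v ^~ x @ \oo --> l%:E.
  by move=> ul; apply/fine_cvgP; split => //; exact: nearW.
have cvgE x : cvgn (u ^~ x) <-> (s x == i x) && (s x \is a fin_num).
  split=> [/cvg_ex[l ul]|/andP[/eqP si /fineK sf]].
    have /cvg_limn_einf_sup[il sl] := cvgv _ _ ul.
    by rewrite /s /i il sl eqxx.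
  apply/cvg_ex; exists (fine (s x)).
  suff /fine_cvgP[_ //] : v ^~ x @ \oo --> (fine (s x))%:E.
  rewrite sf.
  apply: (@squeeze_cvge _ _ _ _ (einfs (v ^~ x)) _ (esups (v ^~ x))).
  - apply: nearW => n; apply/andP; split.
      by apply: ereal_inf_lbound; exists n => /=.
    by apply: ereal_sup_ubound; exists n => /=.
  - rewrite si /i limn_einf_lim; exact: is_cvg_einfs.
  - rewrite /s limn_esup_lim; exact: is_cvg_esups.
have -> : (fun x => limn (u ^~ x)) =
    (fun x => if (s x == i x) && (s x \is a fin_num) then fine (s x) else 0).
  apply/funext => x; case: ifPn => [/cvgE ux|nux].
    have /cvg_ex[l ul] := ux.
    have /cvg_limn_einf_sup[_ sl] := cvgv _ _ ul.
    by rewrite /s sl/=; exact: cvg_lim.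
  have nc : ~ cvgn (u ^~ x) by apply: contraNnot nux => /cvgE.
  by rewrite dvgP.
apply: measurable_fun_ifT.
- apply: measurable_and; first exact: measurable_fun_eqe.
  apply: (measurable_fun_bool true); exact: emeasurable_fin_num.
- exact: measurableT_comp.
- exact: measurable_cst.
Qed.

Section dyadic_sums.
Context {R : realType} {d : nat}.
Implicit Types (Q F : dyadic d) (x y : 'rV[R]_d) (f : 'rV[R]_d -> R) (k : int)
  (m n : nat).

(** The map [dcube k] takes countably many values, each on a cube. *)
Lemma measurable_fun_dcube k (phi : dyadic d -> R) :
  measurable_fun [set: borelR R d] (fun x => phi (dcube k x)).
Proof.
move=> _ Y mY; rewrite setTI.
have -> : (fun x => phi (dcube k x)) @^-1` Y = \bigcup_(Q : dyadic d)
    (if `[<Q.1 = k /\ Y (phi Q)>] then (cube R Q : set (borelR R d)) else set0).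
  apply/seteqP; split=> x /=.
    move=> Yx; exists (dcube k x) => //; rewrite ifT; last exact/asboolP.
    exact: cube_dcube.
  by move=> [Q _]; case: ifPn => // /asboolP[<- YQ] /cubeE ->.
apply: countable_bigcupT_measurable; first exact: countableP.
by move=> Q; case: ifP => // _; exact: measurable_cube.
Qed.

Variable mu : {measure set (borelR R d) -> \bar R}.

Lemma mdiff_out f Q x : ~ cube R Q x -> mdiff mu f Q x = 0.
Proof.
move=> nQx; rewrite /mdiff indicE memNset// mulr0 subr0 fsbig1// => Q' PQ'.
rewrite indicE memNset ?mulr0// => /cubeE h; apply: nQx; apply/cubeE.
have PQ : parent Q' = Q by [].
by rewrite -[in RHS]PQ -[in RHS]h parent_dcube -PQ.
Qed.

Lemma mdiff_in f k x : mdiff mu f (dcube k x) x =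
  avg mu f (dcube (k + 1) x) - avg mu f (dcube k x).
Proof.
rewrite /mdiff [\1_(cube R (dcube k x)) x]indicE mem_set ?mulr1; last exact: cube_dcube.
congr (_ - _).
rewrite -(@fsbig_widen _ _ _ _ [set dcube (k + 1) x]).
- rewrite fsbig_set1 indicE mem_set ?mulr1//; exact: cube_dcube.
- by move=> _ ->; rewrite /children /= parent_dcube addrK.
- move=> Q' [] /= PQ' nQ'; rewrite indicE memNset ?mulr0// => /cubeE h.
  apply: nQ'; rewrite -h; congr (dcube _ _).
  by have /(congr1 fst)/= <- : parent Q' = dcube k x by []; rewrite subrK.
Qed.

Variable eps : dyadic d -> R.

(** The contribution of generation [k] to the transform at [x]. *)
Definition term f k x : R :=
  eps (dcube k x) * (avg mu f (dcube (k + 1) x) - avg mu f (dcube k x)).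

Lemma partial_sumE f x n :
  \sum_(Q \in [set Q : dyadic d | (`|Q.1| <= n)%N]) eps Q * mdiff mu f Q x =
  \sum_(0 <= j < n.*2.+1) term f (j%:Z - n%:Z) x.
Proof.
pose h (j : nat) : dyadic d := dcube (j%:Z - n%:Z) x.
rewrite big_mkord (fsbig_ord _ _ (fun j => term f (j%:Z - n%:Z) x)).
rewrite -(@fsbig_widen _ _ _ _ (h @` `I_(n.*2.+1))).
- rewrite fsbig_image; last by move=> i j _ _ /(congr1 fst)/=; lia.
  by apply: eq_fsbigr => j _; rewrite mdiff_in.
- by move=> _ [j /= jn <-] /=; lia.
- move=> Q [/= Qn nQ]; rewrite mdiff_out ?mulr0// => /cubeE h'.
  apply: nQ; exists (absz (Q.1 + n%:Z)) => /=; first by lia.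
  by rewrite /h -[RHS]h'; congr (dcube _ _); lia.
Qed.

Lemma martingale_transformE f x : martingale_transform mu eps f x =
  limn (fun n => \sum_(0 <= j < n.*2.+1) term f (j%:Z - n%:Z) x).
Proof.
by rewrite /martingale_transform; under eq_fun do rewrite partial_sumE.
Qed.

Lemma measurable_martingale_transform f :
  measurable_fun [set: borelR R d] (martingale_transform mu eps f : borelR R d -> R).
Proof.
rewrite (_ : martingale_transform mu eps f = fun x =>
  limn (fun n => \sum_(0 <= j < n.*2.+1) term f (j%:Z - n%:Z) x)); last first.
  by apply/funext => x; exact: martingale_transformE.
apply: (@measurable_fun_limn _ (borelR R d) R
  (fun n (x : borelR R d) => \sum_(0 <= j < n.*2.+1) term f (j%:Z - n%:Z) x)) => n.
apply: measurable_sum => j.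
apply: measurable_funM.
  exact: measurable_fun_dcube.
by apply: measurable_funB; exact: (measurable_fun_dcube _ (avg mu f)).
Qed.

End dyadic_sums.

(** * Averages *)

Section averages.
Context {R : realType} {d : nat}.
Implicit Types (Q E F : dyadic d) (f g : 'rV[R]_d -> R).
Variable mu : {measure set (borelR R d) -> \bar R}.
Hypothesis hmu : locally_finite mu.

Local Notation mass Q := (fine (mu (cube R Q))).
Local Notation integrable_on Q f := (mu.-integrable (cube R Q) (EFin \o f)).

Lemma mass_ge0 Q : 0 <= mass Q.
Proof. exact: fine_ge0. Qed.

Lemma massE Q : mu (cube R Q) = (mass Q)%:E.
Proof. by rewrite fineK// ge0_fin_numE//; exact: cube_finite. Qed.

Lemma integrable_cst Q (c : R) : integrable_on Q (cst c).
Proof.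
apply/integrableP; split; first exact: (measurable_cst c%:E).
rewrite (integral_cst _ (measurable_cube Q) `|c|%:E).
by rewrite massE -EFinM ltry.
Qed.

(** This also holds when the cube is null, as both sides then vanish. *)
Lemma avg_mass f Q : integrable_on Q f ->
  avg mu f Q * mass Q = Rintegral mu (cube R Q) f.
Proof.
move=> fi; rewrite /avg; have [m0|m0] := eqVneq (mass Q) 0; last by rewrite divfK.
rewrite m0 mulr0 /Rintegral null_set_integral//.
- exact: measurable_cube.
- by case/integrableP : fi.
- by rewrite massE m0.
Qed.

Lemma avg_abs_ge0 f Q : 0 <= avg mu (fun y => `|f y|) Q.
Proof. by rewrite /avg divr_ge0// ?mass_ge0// Rintegral_ge0. Qed.

Lemma normr_avg_le f Q : integrable_on Q f ->
  `|avg mu f Q| <= avg mu (fun y => `|f y|) Q.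
Proof.
move=> fi; rewrite /avg normrM normfV (ger0_norm (mass_ge0 Q)).
apply: ler_wpM2r; first by rewrite invr_ge0 mass_ge0.
by apply: le_normr_Rintegral => //; exact: measurable_cube.
Qed.

Lemma avgB f g Q : integrable_on Q f -> integrable_on Q g ->
  avg mu (fun x => f x - g x) Q = avg mu f Q - avg mu g Q.
Proof.
by move=> fi gi; rewrite /avg RintegralB//; [rewrite mulrBl|exact: measurable_cube].
Qed.

Lemma integrable_EFin_sum (s : seq (dyadic d)) (h : dyadic d -> 'rV[R]_d -> R)
    (D : set (borelR R d)) : measurable D ->
  (forall E, mu.-integrable D (EFin \o h E)) ->
  mu.-integrable D (EFin \o (fun x => \sum_(E <- s) h E x)).
Proof.
move=> mD hi; have := integrable_sum mD s (P := xpredT) (fun E _ => hi E).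
by congr (mu.-integrable D _); apply/funext => x /=; rewrite sumEFin.
Qed.

Lemma avg_sum (s : seq (dyadic d)) (h : dyadic d -> 'rV[R]_d -> R) Q :
  (forall E, integrable_on Q (h E)) ->
  avg mu (fun x => \sum_(E <- s) h E x) Q = \sum_(E <- s) avg mu (h E) Q.
Proof.
move=> hi; have mQ := measurable_cube Q.
rewrite /avg -mulr_suml; congr (_ / _); elim: s => [|E s IH].
  rewrite big_nil (_ : (fun x => _) = cst 0); first by rewrite Rintegral_cst ?mul0r.
  by apply/funext => x; rewrite big_nil.
rewrite big_cons -IH -RintegralD//; last exact: integrable_EFin_sum.
by apply: eq_Rintegral => x _; rewrite big_cons.
Qed.

(** Replacing [f] by its average on [E] amounts to subtracting [fluct f E], so that
stopped functions are finite combinations of these. *)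
Definition fluct f E : 'rV[R]_d -> R := (fun x => f x - avg mu f E) \_ (cube R E).

Lemma integrable_sub_cst f E : integrable_on E f ->
  integrable_on E (fun x => f x - avg mu f E).
Proof.
move=> fi.
rewrite (_ : _ \o _ = (EFin \o f) \- (EFin \o cst (avg mu f E)))%E.
  by apply: integrableB => //; [exact: measurable_cube|exact: integrable_cst].
by apply/funext => x.
Qed.

Lemma integrable_fluct f E : integrable_on E f ->
  mu.-integrable [set: borelR R d] (EFin \o fluct f E).
Proof.
move=> fi; rewrite /fluct -restrict_EFin.
apply/(integrable_mkcond _ (measurable_cube E)).
exact: integrable_sub_cst.
Qed.

Lemma integrable_fluct_on f E Q : integrable_on E f -> integrable_on Q (fluct f E).
Proof.
move=> /integrable_fluct; apply: integrableS => //; exact: measurable_cube.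
Qed.

Lemma avg_fluct_sup f E Q : integrable_on E f -> cube R E `<=` cube R Q ->
  avg mu (fluct f E) Q = 0.
Proof.
move=> fi EQ; rewrite /avg /fluct -Rintegral_mkcondr (setIidr EQ).
rewrite RintegralB//; [|exact: measurable_cube|exact: integrable_cst].
rewrite Rintegral_cst; last exact: measurable_cube.
by rewrite avg_mass// subrr mul0r.
Qed.

(** On a null cube the left-hand side is 0 whatever the averages on the right, whence the
restriction on the mass. *)
Lemma avg_fluct_sub f E Q : (forall P, integrable_on P f) -> mass Q != 0 ->
  cube R Q `<=` cube R E -> avg mu (fluct f E) Q = avg mu f Q - avg mu f E.
Proof.
move=> fi m0 QE; rewrite /avg /fluct -Rintegral_mkcondr (setIidl QE) -/(avg mu f E).
rewrite RintegralB//; [|exact: measurable_cube|exact: integrable_cst].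
rewrite Rintegral_cst; last exact: measurable_cube.
by rewrite mulrBl mulfK.
Qed.

Lemma avg_fluct_disj f E Q : cube R Q `&` cube R E = set0 ->
  avg mu (fluct f E) Q = 0.
Proof.
by move=> QE; rewrite /avg /fluct -Rintegral_mkcondr QE Rintegral_set0 mul0r.
Qed.

Definition abs_int f Q : \bar R := (\int[mu]_(x in cube R Q) `|f x|%:E)%E.

Lemma abs_int_fin f Q : integrable_on Q f -> 
  abs_int f Q = (avg mu (fun y => `|f y|) Q * mass Q)%:E.
Proof.
move=> fi.
have afi : integrable_on Q (fun y => `|f y|) by exact: integrable_norm.
rewrite avg_mass// /Rintegral fineK//.
by apply: integrable_fin_num => //; exact: measurable_cube.
Qed.

Lemma L1_fluct f E : integrable_on E f ->
  (L1_norm mu (fluct f E) <= 2%:E * abs_int f E)%E.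
Proof.
move=> fi.
have mf : measurable_fun (cube R E : set (borelR R d)) (f : borelR R d -> R).
  by case/integrableP : fi => /measurable_EFinP.
have -> : L1_norm mu (fluct f E) = (\int[mu]_(x in cube R E) `|f x - avg mu f E|%:E)%E.
  rewrite /L1_norm [RHS]integral_mkcond; apply: eq_integral => x _ /=.
  rewrite /fluct !patchE; case: ifPn => //; by rewrite normr0.
apply: (@le_trans _ _ (\int[mu]_(x in cube R E) (`|f x|%:E + `|avg mu f E|%:E))%E).
  apply: ge0_le_integral => //.
  - exact: measurable_cube.
  - by apply/measurable_EFinP; apply: measurableT_comp => //; apply: measurable_funB.
  - apply: emeasurable_funD => //.
    by apply/measurable_EFinP; apply: measurableT_comp.
  - by move=> x _; rewrite -EFinD lee_fin ler_normB.
rewrite ge0_integralD//; last 2 first.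
- exact: measurable_cube.
- by apply/measurable_EFinP; apply: measurableT_comp.
rewrite integral_cst/=; last exact: measurable_cube.
rewrite -/(abs_int f E) abs_int_fin// massE -!EFinM -EFinD lee_fin.
rewrite mulr_natl mulr2n lerD2l ler_wpM2r ?mass_ge0//.
exact: normr_avg_le.
Qed.

End averages.

(** * Partial sums over generations *)

(** Splits a sum over the generations -n, ..., n at a generation [k]. *)
Lemma symmetric_sum_split {V : nmodType} (t : int -> V) (k : int) (n : nat) :
  (absz k <= n)%N ->
  \sum_(0 <= j < n.*2.+1) t (j%:Z - n%:Z) =
  \sum_(0 <= j < absz (k + n%:Z)) t (j%:Z - n%:Z) +
  \sum_(0 <= i < n.*2.+1 - absz (k + n%:Z)) t (k + i%:Z).
Proof.
move=> kn; rewrite (@big_cat_nat _ _ _ (absz (k + n%:Z)))/=; [|lia|lia].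
congr (_ + _); rewrite -{1}[absz _]add0n big_addn; apply: eq_bigr => i _.
by congr t; lia.
Qed.

Section dyadic_estimates.
Context {R : realType} {d : nat}.
Implicit Types (Q E F P : dyadic d) (f g : 'rV[R]_d -> R) (x y : 'rV[R]_d) (k : int)
  (m n : nat).
Variable mu : {measure set (borelR R d) -> \bar R}.
Hypothesis hmu : locally_finite mu.

Local Notation mass Q := (fine (mu (cube R Q))).
Local Notation integrable_on Q f := (mu.-integrable (cube R Q) (EFin \o f)).

(** Off this set no cube of the chain [dcube k x] is null, so averages may be divided
and multiplied by masses freely. *)
Definition null_cubes : set (borelR R d) :=
  \bigcup_(Q : dyadic d) (if mass Q == 0 then cube R Q else set0).

Lemma null_cubes_negligible : mu.-negligible null_cubes.
Proof.
pose N n := if (choice.unpickle n : option (dyadic d)) is Some Q then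
  (if mass Q == 0 then cube R Q else set0) else set0.
have -> : null_cubes = \bigcup_n N n.
  apply/seteqP; split=> x [i _ ix].
    by exists (choice.pickle i) => //; rewrite /N choice.pickleK.
  by move: ix; rewrite /N; case: choice.unpickle => // Q ?; exists Q.
apply: negligible_bigcup => n; rewrite /N; case: choice.unpickle => [Q|]; last exact: negligible_set0.
case: eqP => [m0|_]; last exact: negligible_set0.
exists (cube R Q); split => //; first exact: measurable_cube.
by rewrite massE// m0.
Qed.

Lemma measurable_null_cubes : measurable null_cubes.
Proof.
apply: countable_bigcupT_measurable; first exact: countableP.
by move=> Q; case: ifP => // _; exact: measurable_cube.
Qed.

Lemma mass_dcube k x : ~ null_cubes x -> 0 < mass (dcube k x).
Proof.
move=> nx; rewrite lt_neqAle mass_ge0 andbT eq_sym; apply/negP => m0.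
by apply: nx; exists (dcube k x) => //; rewrite m0; exact: cube_dcube.
Qed.

Lemma le_mass Q E : cube R Q `<=` cube R E -> mass Q <= mass E.
Proof.
move=> QE; rewrite -lee_fin -!massE//; apply: le_measure => //; rewrite in_setE;
exact: measurable_cube.
Qed.

Variable eps : dyadic d -> R.
Hypothesis heps : forall Q, `|eps Q| <= 1.

Lemma normr_term_le f k x : `|term mu eps f k x| <=
  `|avg mu f (dcube (k + 1) x) - avg mu f (dcube k x)|.
Proof. by rewrite /term normrM ler_piMl. Qed.

(** Above [F] every average of [f] is the integral of [f] over [F] divided by the mass of
the cube.  These have a common sign and increase in absolute value as the cube
shrinks, so the absolute differences telescope. *)
Lemma coarse_sum_le f F x n : (forall Q, integrable_on Q f) ->
  (forall y, ~ cube R F y -> f y = 0) -> cube R F x -> ~ null_cubes x ->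
  (absz F.1 <= n)%N ->
  `|\sum_(0 <= j < absz (F.1 + n%:Z)) term mu eps f (j%:Z - n%:Z) x|
    <= avg mu (fun y => `|f y|) F.
Proof.
move=> fi fF Fx nx Fn; set J := absz _.
pose I := Rintegral mu (cube R F) f.
pose a (j : nat) := `|I| / mass (dcube (j%:Z - n%:Z) x).
have dF : dcube F.1 x = F by exact/cubeE.
have avgE k : k <= F.1 -> avg mu f (dcube k x) = I / mass (dcube k x).
  move=> kF; rewrite /avg /I; congr (_ / _).
  have FQ : cube R F `<=` cube R (dcube k x) by rewrite -dF; exact: cube_dcube_sub.
  rewrite -[in RHS](setIidr FQ) Rintegral_mkcondr; apply: eq_Rintegral => y _.
  by rewrite patchE; case: ifPn => //; rewrite notin_setE => /fF.
have aJ : a J <= avg mu (fun y => `|f y|) F.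
  rewrite -[X in _ <= avg _ _ X]dF.
  apply: (le_trans _ (normr_avg_le mu _ _ (fi _))).
  rewrite avgE// normrM normfV (ger0_norm (mass_ge0 _ _)) /a.
  by rewrite (_ : J%:Z - n%:Z = F.1)//; rewrite /J; lia.
apply: le_trans aJ.
have a0 j : 0 <= a j by rewrite /a divr_ge0// mass_ge0.
apply: (@le_trans _ _ (a J - a 0%N)); last by rewrite gerDl oppr_le0.
rewrite -(telescope_sumr a (leq0n J)); apply: le_trans (ler_norm_sum _ _ _) _.
rewrite big_nat_cond [leRHS]big_nat_cond; apply: ler_sum => j; rewrite andbT => /andP[_ jJ].
apply: le_trans (normr_term_le _ _ _) _.
rewrite !avgE; [|rewrite /J in jJ; lia|rewrite /J in jJ; lia].
rewrite -mulrBr normrM /a -mulrBr.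
have -> : j.+1%:Z - n%:Z = j%:Z - n%:Z + 1 by lia.
rewrite [X in _ * X]ger0_norm// subr_ge0 lef_pV2 ?posrE ?mass_dcube//.
by apply: le_mass; apply: cube_dcube_sub; lia.
Qed.

(** The part of the transform coming from the [m] generations starting at [k]; as a
function of [x] it is constant on cubes of generation [k + m]. *)
Definition locsum f k m x := \sum_(0 <= i < m) term mu eps f (k + i%:Z) x.

Lemma locsum_dcube f k m x y : dcube (k + m%:Z) x = dcube (k + m%:Z) y ->
  locsum f k m x = locsum f k m y.
Proof.
move=> e; rewrite /locsum big_nat_cond [RHS]big_nat_cond.
apply: eq_bigr => i; rewrite andbT => /andP[_ im].
have e' j : j <= k + m%:Z -> dcube j x = dcube j y by move=> jm; exact: dcube_le jm e.
by rewrite /term !e'//; lia.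
Qed.

Lemma locsum_cat f k m n x :
  locsum f k (m + n) x = locsum f k m x + locsum f (k + m%:Z) n x.
Proof.
rewrite /locsum (@big_cat_nat _ _ _ m)/= ?leq_addr//; congr (_ + _).
rewrite -{1}[m]add0n big_addn addKn; apply: eq_bigr => i _.
by rewrite PoszD; congr term; lia.
Qed.

Lemma sum_abs_int_le f F (s : seq (dyadic d)) : integrable_on F f -> uniq s ->
  (forall E, E \in s -> cube R E `<=` cube R F) ->
  (forall E P x, E \in s -> P \in s -> cube R E x -> cube R P x -> E = P) ->
  (\sum_(E <- s) abs_int mu f E <= abs_int mu f F)%E.
Proof.
move=> fi us sF sD.
have mf : measurable_fun (cube R F : set (borelR R d)) (fun x : borelR R d => `|f x|%:E).
  apply/measurable_EFinP; apply: measurableT_comp => //.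
  by case/integrableP : fi => /measurable_EFinP.
have UF : \big[setU/set0]_(E <- s) cube R E `<=` cube R F.
  by rewrite -bigcup_seq => x [E /= Es Ex]; exact: sF Ex.
rewrite /abs_int -(@ge0_integral_bigsetU _ _ _ _ _
  (fun E => cube R E : set (borelR R d)) (fun x => `|f x|%:E)) //.
- apply: ge0_subset_integral => //.
  + by apply: bigsetU_measurable => E _; exact: measurable_cube.
  + exact: measurable_cube.
- by move=> E; exact: measurable_cube.
- by move=> E P /= Es Ps [x [Ex Px]]; exact: sD Es Ps Ex Px.
- apply: measurable_funS mf => //; exact: measurable_cube.
Qed.

End dyadic_estimates.

(** * Stopped functions and the weak-type inequality *)

Section stopped_function.
Context {R : realType} {d : nat}.
Implicit Types (Q E F P : dyadic d) (x y : 'rV[R]_d) (k : int)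
  (m n : nat).
Variable mu : {measure set (borelR R d) -> \bar R}.
Hypothesis hmu : locally_finite mu.
Variable eps : dyadic d -> R.

Local Notation mass Q := (fine (mu (cube R Q))).
Local Notation integrable_on Q f := (mu.-integrable (cube R Q) (EFin \o f)).

Variable f : 'rV[R]_d -> R.
Hypothesis fi : forall Q, integrable_on Q f.
Variables (F : dyadic d) (s : seq (dyadic d)).
Hypothesis us : uniq s.
Hypothesis sF : forall E, E \in s -> F.1 <= E.1 /\ cube R E `<=` cube R F.
Hypothesis sD : forall E P x,
  E \in s -> P \in s -> cube R E x -> cube R P x -> E = P.

(** This is the difference between [f] stopped at the cubes of [s] and the average of [f]
on [F], restricted to [F]; subtracting the average removes all differences above [F]. *)
Definition stopped : 'rV[R]_d -> R :=
  fun x => fluct mu f F x - \sum_(E <- s) fluct mu f E x.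

Lemma avg_stopped Q : avg mu stopped Q =
  avg mu (fluct mu f F) Q - \sum_(E <- s) avg mu (fluct mu f E) Q.
Proof.
have fluct_on P : integrable_on Q (fluct mu f P) by exact: integrable_fluct_on.
rewrite avgB//; first by rewrite avg_sum.
by apply: integrable_EFin_sum => //; exact: measurable_cube.
Qed.

Lemma avg_stopped_coarse k x : cube R F x -> k <= F.1 ->
  avg mu stopped (dcube k x) = 0.
Proof.
move=> /cubeE Fx kF.
have FQ : cube R F `<=` cube R (dcube k x).
  by rewrite -{1}Fx; exact: cube_dcube_sub.
rewrite avg_stopped avg_fluct_sup// big_seq big1 ?subr0// => E Es.
by rewrite avg_fluct_sup//; apply: subset_trans FQ; case: (sF _ Es).
Qed.

Variables (E : dyadic d) (x : 'rV[R]_d).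
Hypothesis Es : E \in s.
Hypothesis Ex : cube R E x.
Hypothesis nx : ~ null_cubes mu x.

Lemma stopped_root : cube R F x. Proof. by case: (sF _ Es) => _; apply. Qed.

Lemma avg_fluct_root k : F.1 <= k ->
  avg mu (fluct mu f F) (dcube k x) = avg mu f (dcube k x) - avg mu f F.
Proof.
move=> Fk; apply: avg_fluct_sub => //; first by rewrite gt_eqF// mass_dcube.
by have /cubeE <- := stopped_root; exact: cube_dcube_sub.
Qed.

(** Each stopping cube is either disjoint from [dcube k x] or contained in it, in which
case replacing [f] by its average there does not change the integral: a strictly
larger stopping cube would meet, hence equal, [E]. *)
Lemma avg_stopped_mid k : F.1 <= k -> k <= E.1 ->
  avg mu stopped (dcube k x) = avg mu f (dcube k x) - avg mu f F.
Proof.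
move=> Fk kE; rewrite avg_stopped avg_fluct_root// big_seq big1 ?subr0// => P Ps.
have [[y [Qy Py]]|PQ] := pselect (cube R (dcube k x) `&` cube R P !=set0); last first.
  by apply: avg_fluct_disj; apply/eqP; rewrite -[_ == _]negbK; apply/negP => /set0P.
have [kP|Pk] := leP k P.1.
  by apply: avg_fluct_sup => //; exact: (cube_nested _ _ y).
have PE : P = E.
  apply: (sD _ _ x) => //.
  by apply: (cube_nested (dcube k x) P y) => //; [exact: ltW|exact: cube_dcube].
by move: Pk; rewrite PE ltNge kE.
Qed.

Lemma avg_stopped_fine k : E.1 <= k ->
  avg mu stopped (dcube k x) = avg mu f E - avg mu f F.
Proof.
move=> Ek; have [FE _] := sF _ Es.
have QE : cube R (dcube k x) `<=` cube R E.
  by have /cubeE <- := Ex; exact: cube_dcube_sub.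
rewrite avg_stopped avg_fluct_root ?(le_trans FE)// (bigD1_seq E)//= big_seq_cond big1 => [|P].
  rewrite avg_fluct_sub//; first by ring.
  by rewrite gt_eqF// mass_dcube.
move=> /andP[Ps PE]; apply: avg_fluct_disj; apply/eqP; rewrite -[_ == _]negbK.
apply/negP => /set0P[y [Qy Py]]; case/eqP: PE.
by apply: (sD _ _ y) => //; exact: QE.
Qed.

(** The averages of the stopped function are constant along the chain above [F] and
below [E], and in between they are those of [f] up to a constant.  So the defining
sequence is eventually constant at such points. *)
Lemma martingale_transform_stopped m : E.1 = F.1 + m%:Z ->
  martingale_transform mu eps stopped x = locsum mu eps f F.1 m x.
Proof.
have Fx := stopped_root.
move=> Em; rewrite martingale_transformE; apply: lim_near_cst => //.
near=> n.
have Fn : (absz F.1 + m <= n)%N by near: n; exact: nbhs_infty_ge.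
rewrite (symmetric_sum_split (fun k => term mu eps stopped k x) F.1); last by lia.
rewrite big_nat_cond big1 ?add0r => [|j]; last first.
  move=> /andP[/andP[_ jF] _]; rewrite /term !avg_stopped_coarse//; [|lia|lia].
  by rewrite subrr mulr0.
rewrite (@big_cat_nat _ _ _ m)//=; last by lia.
rewrite [X in _ + X]big_nat_cond [X in _ + X]big1 ?addr0 => [|j]; last first.
  move=> /andP[/andP[mj _] _]; rewrite /term !avg_stopped_fine//; [|lia|lia].
  by rewrite subrr mulr0.
rewrite /locsum big_nat_cond [RHS]big_nat_cond; apply: eq_bigr => j.
move=> /andP[/andP[_ jm] _]; rewrite /term !avg_stopped_mid//; [|lia|lia|lia|lia].
by congr (_ * _); ring.
Unshelve. all: by end_near. Qed.

End stopped_function.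

Section weak_type.
Context {R : realType} {d : nat}.
Implicit Types (Q E F P : dyadic d) (x y : 'rV[R]_d) (k : int)
  (m n : nat).
Variable mu : {measure set (borelR R d) -> \bar R}.
Hypothesis hmu : locally_finite mu.
Variable eps : dyadic d -> R.

Local Notation mass Q := (fine (mu (cube R Q))).
Local Notation integrable_on Q f := (mu.-integrable (cube R Q) (EFin \o f)).

Variable f : 'rV[R]_d -> R.
Hypothesis fi : forall Q, integrable_on Q f.
Variables (F : dyadic d) (s : seq (dyadic d)).
Hypothesis us : uniq s.
Hypothesis sF : forall E, E \in s -> F.1 <= E.1 /\ cube R E `<=` cube R F.
Hypothesis sD : forall E P x,
  E \in s -> P \in s -> cube R E x -> cube R P x -> E = P.

Lemma integrable_stopped :
  mu.-integrable [set: borelR R d] (EFin \o stopped mu f F s).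
Proof.
rewrite (_ : _ \o _ = (EFin \o fluct mu f F) \-
   (EFin \o (fun x => \sum_(E <- s) fluct mu f E x)%R))%E; last first.
  by apply/funext => x.
apply: integrableB => //; first exact: integrable_fluct.
by apply: integrable_EFin_sum => // E; exact: integrable_fluct.
Qed.

(** Each [fluct f E] has norm at most twice the integral of |f| on [E]; the factor 2 is
paid once on [F] and once on the disjoint cubes of [s]. *)
Lemma L1_stopped : (L1_norm mu (stopped mu f F s) <= 4%:E * abs_int mu f F)%E.
Proof.
have mfl E : measurable_fun [set: borelR R d] (fun x : borelR R d => `|fluct mu f E x|%:E).
  apply/measurable_EFinP; apply: measurableT_comp => //.
  apply/measurable_EFinP; apply: (measurable_int mu).
  by apply: integrable_fluct; [exact: hmu|exact: fi].
apply: (@le_trans _ _ (L1_norm mu (fluct mu f F) + \sum_(E <- s) L1_norm mu (fluct mu f E))%E).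
  rewrite /L1_norm -ge0_integral_sum// -ge0_integralD//; last 2 first.
  - by move=> x _; apply: sume_ge0.
  - by apply: emeasurable_sum => E.
  apply: ge0_le_integral => //.
  - apply/measurable_EFinP; apply: measurableT_comp => //.
    by apply/measurable_EFinP; apply: (measurable_int mu); exact: integrable_stopped.
  - by apply: emeasurable_funD => //; apply: emeasurable_sum => E.
  - move=> x _; rewrite sumEFin -EFinD lee_fin /stopped.
    by apply: le_trans (ler_normB _ _) _; rewrite lerD2l; exact: ler_norm_sum.
apply: (@le_trans _ _ (2%:E * abs_int mu f F + \sum_(E <- s) 2%:E * abs_int mu f E)%E).
  apply: leeD; first exact: L1_fluct.
  by apply: lee_sum => E _; exact: L1_fluct.
have -> : (4%:E * abs_int mu f F = 2%:E * abs_int mu f F + 2%:E * abs_int mu f F)%E.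
  by rewrite abs_int_fin// -!EFinM -EFinD; congr (_%:E); ring.
rewrite leeD2l// -ge0_sume_distrr; last by move=> E _; exact: integral_ge0.
rewrite lee_pmul2l//; apply: sum_abs_int_le => // E Es.
by case: (sF _ Es).
Qed.

(** Up to the null cubes, the cubes of [s] lie in the superlevel set at height [lam] of
the transform of the stopped function, to which the weak-type inequality applies. *)
Lemma weak_type_stopping (c lam : R) : 0 < lam ->
  (forall g, mu.-integrable [set: borelR R d] (EFin \o g) ->
     (weakL1_norm mu (martingale_transform mu eps g) <= c%:E * L1_norm mu g)%E) ->
  0 <= c ->
  (forall E x, E \in s -> cube R E x ->
     lam < `|locsum mu eps f F.1 (absz (E.1 - F.1)) x|) ->
  lam * \sum_(E <- s) mass E <= c * 4 * (avg mu (fun y => `|f y|) F * mass F).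
Proof.
move=> lam0 hT c0 hs.
set g := stopped mu f F s.
pose W : set (borelR R d) := [set x | lam < `|martingale_transform mu eps g x|].
have mW : measurable W.
  have mT : measurable_fun [set: borelR R d]
      (fun x : borelR R d => `|martingale_transform mu eps g x|).
    by apply: measurableT_comp => //; exact: measurable_martingale_transform.
  have := mT measurableT _ (measurable_itv `]lam, +oo[).
  rewrite setTI; congr (measurable _); apply/seteqP.
  by split=> x /=; rewrite in_itv/= andbT.
pose U : set (borelR R d) := \bigcup_(E in [set` s]) cube R E.
have fs : finite_set [set` s] by exact: finite_seq.
have UE : mu U = (\sum_(E <- s) mass E)%:E.
  rewrite /U measure_fin_bigcup//.
  - by rewrite -fsbig_seq// -sumEFin; apply: eq_bigr => E _; exact: massE.
  - by move=> E P /= Es Ps [x [Ex Px]]; exact: sD Es Ps Ex Px.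
  - by move=> E _; exact: measurable_cube.
have mU : measurable U.
  by apply: fin_bigcup_measurable => // E _; exact: measurable_cube.
have mN := measurable_null_cubes mu.
have UW : U `<=` W `|` null_cubes mu.
  move=> x [E /= Es Ex].
  have [nx|nx] := pselect (null_cubes mu x); [by right|left].
  have [FE _] := sF _ Es.
  rewrite /W /= /g (@martingale_transform_stopped _ _ _ hmu eps _ fi F s us sF sD
    E x Es Ex nx (absz (E.1 - F.1))).
    exact: hs.
  by rewrite gez0_abs ?subr_ge0// [RHS]addrC subrK.
have N0 : mu (null_cubes mu) = 0%E.
  have [M [mM M0 NM]] := null_cubes_negligible mu hmu.
  exact: subset_measure0 NM M0.
have muUW : (mu U <= mu W)%E.
  rewrite -[leRHS]adde0 -N0; apply: le_trans (measureU2 _ mW mN).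
  by apply: le_measure; rewrite ?in_setE//; exact: measurableU.
have wk : (lam%:E * mu W <= c%:E * L1_norm mu g)%E.
  apply: le_trans (hT g integrable_stopped).
  by apply: ereal_sup_ubound; exists lam.
have fin : (lam%:E * mu U <= c%:E * (4%:E * abs_int mu f F))%E.
  have h1 : (lam%:E * mu U <= lam%:E * mu W)%E by rewrite lee_pmul2l.
  apply: (le_trans h1); apply: (le_trans wk).
  by apply: lee_wpmul2l => //; exact: L1_stopped.
by move: fin; rewrite UE abs_int_fin// -!EFinM lee_fin !mulrA.
Qed.

End weak_type.

(** * The stopping family *)

Section stopping.
Context {R : realType} {d : nat}.
Implicit Types (Q E F G P : dyadic d) (x y : 'rV[R]_d) (k : int)
  (m n : nat).
Variable mu : {measure set (borelR R d) -> \bar R}.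
Hypothesis hmu : locally_finite mu.
Variable eps : dyadic d -> R.
Hypothesis heps : forall Q, `|eps Q| <= 1.

Local Notation mass Q := (fine (mu (cube R Q))).
Local Notation integrable_on Q f := (mu.-integrable (cube R Q) (EFin \o f)).

Variable f : 'rV[R]_d -> R.
Hypothesis fi : forall Q, integrable_on Q f.

Local Notation absavg Q := (avg mu (fun y => `|f y|) Q).
Local Notation L := (locsum mu eps f).

(** If |f| has zero average on [F] then nothing stops below [F] and all partial sums
vanish; this degenerate case must be excluded before dividing by the average. *)
Lemma absavg_eq0_sub F Q : absavg F = 0 -> cube R Q `<=` cube R F -> absavg Q = 0.
Proof.
move=> F0 QF.
have : (\sum_(E <- [:: Q]) abs_int mu f E <= abs_int mu f F)%E.
  apply: sum_abs_int_le => //.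
  - by move=> E; rewrite inE => /eqP ->.
  - by move=> E P x; rewrite !inE => /eqP -> /eqP ->.
rewrite big_seq1 !abs_int_fin// F0 mul0r lee_fin => h.
have [m0|m0] := eqVneq (mass Q) 0; first by rewrite /avg m0 invr0 mulr0.
have mQ : 0 < mass Q by rewrite lt_neqAle eq_sym m0 mass_ge0.
by apply/eqP; rewrite eq_le avg_abs_ge0 andbT -(pmulr_lle0 _ mQ).
Qed.

Lemma normr_term_absavg k x : `|term mu eps f k x| <=
  absavg (dcube (k + 1) x) + absavg (dcube k x).
Proof.
apply: le_trans (normr_term_le mu eps heps f k x) _.
apply: le_trans (ler_normB _ _) _.
by apply: lerD; exact: normr_avg_le.
Qed.

Lemma locsum_eq0 F m x : absavg F = 0 -> cube R F x -> L F.1 m x = 0.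
Proof.
move=> F0 /cubeE Fx; rewrite /locsum big1// => i _; apply/eqP.
have z k : F.1 <= k -> absavg (dcube k x) = 0.
  by move=> Fk; apply: (absavg_eq0_sub F) => //; rewrite -Fx; exact: cube_dcube_sub.
rewrite -normr_le0; apply: le_trans (normr_term_absavg _ _) _.
by rewrite !z ?addr0//; lia.
Qed.

Variable c0 : R.
Hypothesis c0_ge1 : 1 <= c0.

(** The stopping rule.  The factor 10 makes the two kinds of stopping cubes use up at
most 1/10 and 4/10 of the mass of [F]. *)
Definition exceeds F m x :=
  10 * absavg F < absavg (dcube (F.1 + m%:Z) x) \/
  10 * c0 * absavg F < `|L F.1 m x|.

Lemma exceeds_dcube F m x y : dcube (F.1 + m%:Z) x = dcube (F.1 + m%:Z) y ->
  exceeds F m x -> exceeds F m y.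
Proof. by move=> e; rewrite /exceeds e (locsum_dcube _ _ _ _ _ _ _ e). Qed.

Definition stops F E := exists x m, [/\ (0 < m)%N, cube R F x,
  E = dcube (F.1 + m%:Z) x, exceeds F m x &
  forall j, (0 < j < m)%N -> ~ exceeds F j x].

(** The stopping rule depends on the point only through its cube, so it holds at one
point of a stopping cube exactly when it holds at all of them. *)
Lemma stopsP F E : stops F E -> exists2 m, (0 < m)%N /\ E.1 = F.1 + m%:Z &
  cube R E `<=` cube R F /\ forall x, cube R E x ->
    exceeds F m x /\ forall j, (0 < j < m)%N -> ~ exceeds F j x.
Proof.
move=> [x [m [m0 Fx Em bm min]]]; exists m; first by rewrite Em.
have EF : cube R E `<=` cube R F.
  by rewrite Em; have /cubeE {2}<- := Fx; apply: cube_dcube_sub; lia.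
split=> // y Ey.
have e : dcube (F.1 + m%:Z) x = dcube (F.1 + m%:Z) y.
  by move: Ey; rewrite Em => /cubeE.
split; first exact: exceeds_dcube e bm.
move=> j jm; apply: contra_not (min _ jm); apply: exceeds_dcube.
by apply: (dcube_le _ (F.1 + m%:Z)); [lia|].
Qed.

Lemma stops_lt F E : stops F E -> F.1 < E.1.
Proof. by move=> /stopsP[m [m0 ->]] _; lia. Qed.

Lemma stops_sub F E : stops F E -> cube R E `<=` cube R F.
Proof. by move=> /stopsP[m _ []]. Qed.

(** Two stopping cubes with a common point are the first exceeding cube on the chain of
that point. *)
Lemma stops_disjoint F E P x : stops F E -> stops F P ->
  cube R E x -> cube R P x -> E = P.
Proof.
move=> /stopsP[m [m0 Em] [_ Es]] /stopsP[n [n0 Pn] [_ Ps]] Ex Px.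
have [bE minE] := Es _ Ex; have [bP minP] := Ps _ Px.
suff mn : m = n by apply: (cube_same_gen _ _ x) => //; rewrite Em Pn mn.
apply/eqP; rewrite eqn_leq; apply/andP; split; rewrite leqNgt; apply/negP => h.
  by apply: (minE n) => //; rewrite n0.
by apply: (minP m) => //; rewrite m0.
Qed.

Lemma stops_absavg_gt0 F E : stops F E -> 0 < absavg F.
Proof.
move=> sE; rewrite lt_neqAle avg_abs_ge0 andbT; apply/eqP => /esym F0.
have /stopsP[m [m0 Em] [EF /=]] := sE.
have [x Ex] := cube_neq0 (R := R) E.
move=> /(_ _ Ex)[[]] + _.
  rewrite -Em; have /cubeE -> := Ex.
  by rewrite (absavg_eq0_sub F E)// F0 mulr0 ltxx.
by rewrite locsum_eq0// ?F0 ?mulr0 ?normr0 ?ltxx//; exact: EF.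
Qed.

Variable c : R.
Hypothesis c_ge0 : 0 <= c.
Hypothesis c_le : c <= c0.
Hypothesis hT : forall g, mu.-integrable [set: borelR R d] (EFin \o g) ->
  (weakL1_norm mu (martingale_transform mu eps g) <= c%:E * L1_norm mu g)%E.

(** Stated for finite lists, which is all that a sum defined as a supremum of finite
subsums requires. *)
Lemma stops_mass_le F (s : seq (dyadic d)) : uniq s ->
  (forall E, E \in s -> stops F E) -> \sum_(E <- s) mass E <= 2^-1 * mass F.
Proof.
move=> us sF; case: s us sF => [|E0 s'] us sF.
  by rewrite big_nil mulr_ge0// ?invr_ge0// mass_ge0.
have aF := stops_absavg_gt0 _ _ (sF _ (mem_head _ _)).
move: us sF; set s := E0 :: s' => us sF.
pose big E := 10 * absavg F < absavg E.
rewrite (bigID big)/= -[X in X + _]big_filter -[X in _ + X]big_filter.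
set s1 := [seq E <- s | big E]; set s2 := [seq E <- s | ~~ big E].
have s1s E : E \in s1 -> stops F E by rewrite mem_filter => /andP[_ /sF].
have s2s E : E \in s2 -> stops F E by rewrite mem_filter => /andP[_ /sF].
have h1 : 10 * absavg F * \sum_(E <- s1) mass E <= absavg F * mass F.
  have : (\sum_(E <- s1) abs_int mu f E <= abs_int mu f F)%E.
    apply: sum_abs_int_le => //.
    - exact: filter_uniq.
    - by move=> E /s1s/stops_sub.
    - by move=> E P x /s1s Es /s1s Ps; exact: (stops_disjoint F _ _ _ Es Ps).
  under eq_bigr do rewrite abs_int_fin//.
  rewrite abs_int_fin// sumEFin lee_fin; apply: le_trans.
  rewrite mulr_sumr big_seq [leRHS]big_seq; apply: ler_sum => E.
  rewrite mem_filter => /andP[/ltW bE _].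
  by rewrite ler_wpM2r// mass_ge0.
have h2 : 10 * c0 * absavg F * \sum_(E <- s2) mass E <= c * 4 * (absavg F * mass F).
  apply: (weak_type_stopping mu hmu eps f fi F s2) => //.
  - exact: filter_uniq.
  - by move=> E /s2s Es; split; [exact/ltW/stops_lt|exact: stops_sub].
  - by move=> E P x /s2s Es /s2s Ps; exact: (stops_disjoint F _ _ _ Es Ps).
  - by rewrite mulr_gt0// mulr_gt0//; apply: lt_le_trans c0_ge1.
  move=> E x Es2 Ex; have := s2s _ Es2 => /stopsP[m [m0 Em] [_ /(_ _ Ex)[+ _]]].
  move: Es2; rewrite mem_filter /big => /andP[/negP nb _].
  have -> : absz (E.1 - F.1) = m by rewrite Em; lia.
  by case=> //; rewrite -Em; have /cubeE -> := Ex.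
set A1 := \sum_(E <- s1) _ in h1 *; set A2 := \sum_(E <- s2) _ in h2 *.
have mF := mass_ge0 mu F.
have {}h1 : 10 * A1 <= mass F.
  by rewrite -(ler_pM2l aF) mulrA [_ * 10]mulrC.
have {}h2 : 10 * A2 <= 4 * mass F.
  have c00 : 0 < c0 by apply: lt_le_trans c0_ge1.
  rewrite -(ler_pM2l aF) -(ler_pM2l c00).
  apply: (@le_trans _ _ (c * (4 * (absavg F * mass F)))); first by lra.
  have -> : c0 * (absavg F * (4 * mass F)) = c0 * (4 * (absavg F * mass F)) by ring.
  by apply: ler_wpM2r => //; rewrite mulr_ge0// mulr_ge0// avg_abs_ge0.
lra.
Qed.

Variable F0 : dyadic d.

Inductive stopping_family : dyadic d -> Prop :=
| stopping_family_root : stopping_family F0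
| stopping_family_step F E : stopping_family F -> stops F E -> stopping_family E.

Lemma stopping_family_sub F : stopping_family F -> F0.1 <= F.1 /\ cube R F `<=` cube R F0.
Proof.
elim=> [|F1 E _ [FF0 sF] FE]; first by split.
split.
  by rewrite (le_trans FF0)// ltW// stops_lt.
by apply: subset_trans sF; exact: stops_sub.
Qed.

(** Two members of the family with a common point are linked by successive stops.  For
[G] stopped below [G1], either [G1] is below [F] and the induction applies to [G1], or
[F] is [G1]; the remaining position, [F] strictly between [G] and [G1], is impossible,
because [F] would then lie in a stopping cube of [G1], which meets, hence equals, [G]. *)
Lemma stopping_family_chain G F : stopping_family G -> stopping_family F -> F.1 < G.1 ->
  cube R G `<=` cube R F -> exists E, [/\ stops F E, E.1 <= G.1 & cube R G `<=` cube R E].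
Proof.
move: {2}(absz (G.1 - F0.1)) (leqnn (absz (G.1 - F0.1))) => n.
elim: n G F => [|n IH] G F.
  move=> Gn fG fF FG; have [h1 _] := stopping_family_sub _ fG.
  have [h2 _] := stopping_family_sub _ fF.
  by lia.
move=> Gn fG; have [h1 _] := stopping_family_sub _ fG.
case: fG h1 Gn => [|G1 {}G fG1 sG] h1 Gn fF FG GF.
  by have [h2 _] := stopping_family_sub _ fF; lia.
have [h2 _] := stopping_family_sub _ fF; have [h3 _] := stopping_family_sub _ fG1.
have G1G := stops_lt _ _ sG; have GG1 := stops_sub _ _ sG.
have [x Gx] := cube_neq0 (R := R) G.
have [FG1|G1F|FG1] := ltgtP F.1 G1.1.
- have [|||||E [sE EG G1E]] := IH G1 F => //; first by lia.
    by apply: (cube_nested _ _ x); [exact: ltW|exact: GG1|exact: GF].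
  exists E; split=> //; first by lia.
  exact: subset_trans GG1 G1E.
- have [|||||E [sE EF FE]] := IH F G1 => //; first by lia.
    by apply: (cube_nested _ _ x); [exact: ltW|exact: GF|exact: GG1].
  have EG : E = G by apply: (stops_disjoint G1 _ _ x) => //; apply: FE; exact: GF.
  by move: EF; rewrite EG => GF'; lia.
- have <- : G1 = F by apply: (cube_same_gen _ _ x) => //; [exact: GG1|exact: GF].
  by exists G; split.
Qed.

Lemma maxchildren_stops (hd : (0 < d)%N) F E : stopping_family F ->
  maxchildren R stopping_family F E -> stops F E.
Proof.
move=> fF [fE [EF nFE] max].
have [x Ex] := cube_neq0 (R := R) E.
have FE : F.1 < E.1.
  rewrite ltNge; apply/negP => EF'; apply: nFE.
  by apply: (cube_nested _ _ x) => //; exact: EF.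
have [G [sG GE EG]] := stopping_family_chain _ _ fE fF FE EF.
suff <- : G = E by [].
apply: max => //; first exact: stopping_family_step sG.
split; first exact: stops_sub.
by move=> /(cube_sub_gen hd); have := stops_lt _ _ sG; lia.
Qed.

Lemma sparse_stopping_family (hd : (0 < d)%N) : sparse mu stopping_family.
Proof.
exists 2^-1; split; first by rewrite invr_gt0 ltr0n/= invf_lt1// ltr1n.
move=> F fF; apply: ge_ereal_sup => _ [X [finX XF] <-].
rewrite fsbig_finite//= (eq_bigr (fun E => (mass E)%:E)); last first.
  by move=> E _; exact: massE.
rewrite sumEFin massE// -EFinM lee_fin; apply: stops_mass_le.
  exact: fset_uniq.
move=> E; rewrite in_fset_set// in_setE => /XF; exact: maxchildren_stops.
Qed.

(** What a cube of the family contributes to the right-hand side: the parent average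
pays for the single step of the transform that leads into the cube. *)
Definition pavg Q := absavg Q + absavg (parent Q).

Lemma pavg_ge0 Q : 0 <= pavg Q. Proof. by rewrite addr_ge0// avg_abs_ge0. Qed.

(** Reads the family along the chain of [x], turning the sparse sums into finite sums
over generations. *)
Definition weight k x :=
  if `[< stopping_family (dcube k x) >] then pavg (dcube k x) else 0.

Lemma weight_ge0 k x : 0 <= weight k x.
Proof. by rewrite /weight; case: ifP => // _; exact: pavg_ge0. Qed.

Lemma not_exceeds_le F m x : (0 < m)%N -> ~ exceeds F m x -> `|L F.1 m x| <= 10 * c0 * absavg F.
Proof. by move=> m0 nb; rewrite leNgt; apply/negP => h; apply: nb; right. Qed.

(** The term [pavg F] on the left strengthens the induction: for the first stopping cube
[E] it absorbs the cost of the step leading into [E]. *)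
Lemma locsum_family_le m F x : stopping_family F -> cube R F x ->
  `|L F.1 m x| + pavg F <=
    (10 * c0 + 1) * \sum_(0 <= i < m.+1) weight (F.1 + i%:Z) x.
Proof.
elim/ltn_ind: m F => m IH F fF Fx.
have M0 : 0 <= 10 * c0 by rewrite mulr_ge0// (le_trans _ c0_ge1).
have wF : weight (F.1 + 0%:Z) x = pavg F.
  by rewrite addr0 /weight; have /cubeE -> := Fx; rewrite asboolT.
have aF : 10 * c0 * absavg F + pavg F <= (10 * c0 + 1) * pavg F.
  have : 10 * c0 * absavg F <= 10 * c0 * pavg F.
    by rewrite ler_wpM2l// /pavg lerDl avg_abs_ge0.
  by rewrite [(_ + 1) * _]mulrDl mul1r lerD2r.
have L0 : `|L F.1 0 x| <= 10 * c0 * absavg F.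
  by rewrite /locsum big_geq// normr0 mulr_ge0// avg_abs_ge0.
have w0 (I : seq nat) : 0 <= \sum_(i <- I) weight (F.1 + i%:Z) x.
  by apply: sumr_ge0 => i _; exact: weight_ge0.
have [[i /andP[i0 im] bi]|nb] := pselect (exists2 i, (0 < i <= m)%N & exceeds F i x);
    last first.
  have Lm : `|L F.1 m x| <= 10 * c0 * absavg F.
    case: m {IH} nb => [//|m] nb; apply: not_exceeds_le => // b.
    by apply: nb; exists m.+1 => //; rewrite leqnn.
  apply: (@le_trans _ _ (10 * c0 * absavg F + pavg F)); first by rewrite lerD2r.
  apply: (le_trans aF); rewrite ler_wpM2l ?addr_ge0//.
  by rewrite big_nat_recl// wF lerDl; apply: sumr_ge0 => j _; exact: weight_ge0.
(* [j.+1] is the first generation below [F] at which the chain of [x] stops. *)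
have exb : exists i, (0 < i)%N && `[< exceeds F i x >].
  by exists i; rewrite i0/=; exact/asboolP.
case: (ex_minnP exb) => j /andP[j0 /asboolP bj] minj.
have jm : (j <= m)%N.
  by apply: leq_trans im; apply: minj; rewrite i0/=; exact/asboolP.
case: j j0 bj minj jm => // j _ bj minj jm.
have nbk (l : nat) : (0 < l <= j)%N -> ~ exceeds F l x.
  move=> /andP[l0 lj] bl; have := minj l; rewrite l0/= asboolT// => /(_ isT).
  by rewrite ltnNge lj.
pose E := dcube (F.1 + j.+1%:Z) x.
have sE : stops F E by exists x, j.+1; split.
have Ex : cube R E x by exact: cube_dcube.
have := IH (m - j.+1)%N _ E (stopping_family_step _ _ fF sE) Ex; rewrite ltn_subrL/=.
move=> /(_ (leq_trans (ltn0Sn j) jm)) IHE.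
have Lj : `|L F.1 j x| <= 10 * c0 * absavg F.
  case: j {E sE Ex IHE jm bj minj} nbk => [//|j] nbk; apply: not_exceeds_le => //.
  by apply: nbk; rewrite leqnn.
have Lt : `|L (F.1 + j%:Z) 1 x| <= pavg E.
  rewrite /locsum big_nat1 addr0; apply: le_trans (normr_term_absavg _ _) _.
  rewrite /pavg /E parent_dcube.
  have -> : F.1 + j%:Z + 1 = F.1 + j.+1%:Z by rewrite -addrA -PoszD addn1.
  by have -> : F.1 + j.+1%:Z - 1 = F.1 + j%:Z by rewrite -addn1 PoszD addrA addrK.
have -> : L F.1 m x = L F.1 j x + L (F.1 + j%:Z) 1 x + L E.1 (m - j.+1)%N x.
  rewrite -[in LHS](subnK jm) addnC locsum_cat -[in X in X + _]addn1 locsum_cat.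
  by [].
have -> : \sum_(0 <= i < m.+1) weight (F.1 + i%:Z) x =
   pavg F + \sum_(1 <= i < j.+1) weight (F.1 + i%:Z) x +
   \sum_(0 <= i < (m - j.+1).+1) weight (E.1 + i%:Z) x.
  rewrite (@big_cat_nat _ _ _ j.+1)//=; last exact: leqW.
  rewrite big_ltn// wF; congr (_ + _).
  rewrite -{1}[j.+1]add0n big_addn subSn//; apply: eq_bigr => k _.
  by rewrite -addrA -PoszD addnC.
set A := L F.1 j x in Lj *; set B := L _ 1 x in Lt *; set D := L E.1 _ x in IHE *.
set S := \sum_(0 <= i < _) _ in IHE *; set S' := \sum_(1 <= i < _) _.
have S'0 : 0 <= (10 * c0 + 1) * S' by rewrite mulr_ge0 ?addr_ge0// /S' w0.
rewrite 2!mulrDr.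
have n1 := ler_normD (A + B) D; have n2 := ler_normD A B.
lra.
Qed.

End stopping.

(** * Domination *)

(** No convergence is assumed: a divergent sequence has [limn] equal to 0. *)
Lemma normr_limn_le {R : realType} (u : R^nat) (B : R) : 0 <= B ->
  (\forall n \near \oo, `|u n| <= B) -> `|limn u| <= B.
Proof.
move=> B0 uB; have [cu|ncu] := pselect (cvgn u); last by rewrite dvgP// normr0.
have nu : `|u n| @[n --> \oo] --> `|limn u| by exact: cvg_norm.
exact: (cvgr_to_le nu uB).
Qed.

Section domination.
Context {R : realType} {d : nat}.
Implicit Types (Q E F : dyadic d) (x y : 'rV[R]_d) (k : int) (m n : nat).

(** Distinct generations give distinct cubes, so the chain of [x] is a finite subfamily. *)
Lemma esum_path_ge (FF : set (dyadic d)) (b : dyadic d -> R) k m x :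
  ((\sum_(0 <= i < m) (if `[< FF (dcube (k + i%:Z) x) >]
      then b (dcube (k + i%:Z) x) else 0))%:E
   <= \esum_(F in FF) (b F * \1_(cube R F) x)%:E)%E.
Proof.
pose h (i : nat) : dyadic d := dcube (k + i%:Z) x.
pose J : set nat := `I_m `&` [set i | FF (h i)].
have hinj : set_inj J h by move=> i j _ _ /(congr1 fst)/=; lia.
apply: esum_ge; exists (h @` J).
  split; first by apply: finite_image; apply: sub_finite_set (finite_II m) => i [].
  by move=> _ [i [_ Fi] <-].
rewrite fsbig_image// fsbig_mkcondr -fsbig_ord/= big_mkord -sumEFin.
apply: lee_sum => i _.
have -> : ((i : nat) \in [set i | FF (h i)]) = `[< FF (h i) >] by [].
by case: ifP => // _; rewrite indicE mem_set ?mulr1//; exact: cube_dcube.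
Qed.

Variable mu : {measure set (borelR R d) -> \bar R}.
Hypothesis hmu : locally_finite mu.
Variable eps : dyadic d -> R.
Hypothesis heps : forall Q, `|eps Q| <= 1.
Local Notation integrable_on Q f := (mu.-integrable (cube R Q) (EFin \o f)).
Variable f : 'rV[R]_d -> R.
Hypothesis fi : forall Q, integrable_on Q f.
Variable F0 : dyadic d.
Hypothesis fF0 : forall x, ~ cube R F0 x -> f x = 0.

Local Notation T := (martingale_transform mu eps).
Local Notation absavg Q := (avg mu (fun y => `|f y|) Q).

Lemma normr_martingale_transform_le x (B : R) : cube R F0 x -> ~ null_cubes mu x ->
  0 <= B -> (forall m, `|locsum mu eps f F0.1 m x| + absavg F0 <= B) ->
  `|T f x| <= B.
Proof.
move=> F0x nx B0 LB; rewrite martingale_transformE; apply: normr_limn_le => //.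
near=> n.
have Fn : (absz F0.1 <= n)%N by near: n; exact: nbhs_infty_ge.
rewrite (symmetric_sum_split (fun k => term mu eps f k x) F0.1)//.
apply: le_trans (ler_normD _ _) _.
have := LB (n.*2.+1 - absz (F0.1 + n%:Z)%R)%N; apply: le_trans.
rewrite addrC lerD2l.
exact: (coarse_sum_le mu hmu eps heps f F0 x n).
Unshelve. all: by end_near. Qed.

Lemma opnorm_ge0 : (0 <= L1_weakL1_opnorm mu T)%E.
Proof. by apply: le_ereal_inf_tmp => _ [c [c0 _] <-]; rewrite lee_fin. Qed.

Local Notation rhs FF x := (\esum_(F in FF) (absavg F * \1_(cube R F) x)%:E +
  \esum_(F in FF) (absavg (parent F) * \1_(cube R F) x)%:E)%E.

Lemma rhs_ge0 FF x : (0 <= rhs FF x)%E.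
Proof.
apply: adde_ge0; apply: esum_ge0 => F _; rewrite lee_fin mulr_ge0//;
  exact: avg_abs_ge0.
Qed.

Lemma domination_infinite_opnorm x : L1_weakL1_opnorm mu T = +oo%E ->
  cube R F0 x -> ~ null_cubes mu x ->
  (`|T f x|%:E <= 11%:E * (L1_weakL1_opnorm mu T + 1) * rhs [set F0] x)%E.
Proof.
move=> -> F0x nx; rewrite addye// gt0_muley ?lte_fin//.
have := avg_abs_ge0 mu f F0; rewrite le_eqVlt => /orP[/eqP/esym z|p].
  have -> : T f x = 0.
    apply/eqP; rewrite -normr_le0; apply: normr_martingale_transform_le => // m.
    by rewrite (locsum_eq0 mu hmu eps heps f fi)// z normr0 addr0.
  by rewrite normr0 mule_ge0// rhs_ge0.
rewrite gt0_mulye ?leey//.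
apply: (@lt_le_trans _ _ (absavg F0)%:E); first by rewrite lte_fin.
apply: (@le_trans _ _ (\esum_(F in [set F0]) (absavg F * \1_(cube R F) x)%:E)).
  by rewrite esum_set1 indicE mem_set// mulr1 ?lee_fin// avg_abs_ge0.
rewrite leeDl//; apply: esum_ge0 => F _; rewrite lee_fin mulr_ge0//.
exact: avg_abs_ge0.
Qed.

Lemma domination_finite_opnorm (r : R) x : L1_weakL1_opnorm mu T = r%:E ->
  cube R F0 x -> ~ null_cubes mu x ->
  (`|T f x|%:E <= 11%:E * (L1_weakL1_opnorm mu T + 1) *
     rhs (stopping_family mu eps f (r + 1) F0) x)%E.
Proof.
move=> Tr F0x nx; have := opnorm_ge0; rewrite Tr lee_fin => r0.
rewrite -EFinD -EFinM.
have C0 : 0 < 11 * (r + 1) by rewrite mulr_gt0// ltr_wpDl.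
set FF := stopping_family _ _ _ _ _.
have path m : ((\sum_(0 <= i < m) weight mu eps f (r + 1) F0 (F0.1 + i%:Z) x)%:E
    <= rhs FF x)%E.
  have := leeD (esum_path_ge FF (fun F => absavg F) F0.1 m x)
    (esum_path_ge FF (fun F => absavg (parent F)) F0.1 m x).
  apply: le_trans; rewrite -EFinD -big_split/= lee_fin; apply: ler_sum => i _.
  by rewrite /weight -/FF; case: ifP => //; rewrite addr0.
have := rhs_ge0 FF x; case: (rhs FF x) path => [s| |] path s0 //; last first.
  by rewrite gt0_muley ?lte_fin// leey.
rewrite -EFinM lee_fin; apply: normr_martingale_transform_le => //.
  by rewrite mulr_ge0// ltW.
move=> m; have := locsum_family_le mu eps heps f fi (r + 1) _ F0 m F0 x
  (stopping_family_root _ _ _ _ _) F0x.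
rewrite lerDr => /(_ r0) h.
apply: (@le_trans _ _ (`|locsum mu eps f F0.1 m x| + pavg mu f F0)).
  by rewrite lerD2l /pavg lerDl avg_abs_ge0.
apply: (le_trans h); apply: ler_pM.
- by rewrite addr_ge0// mulr_ge0// addr_ge0.
- by apply: sumr_ge0 => i _; exact: weight_ge0.
- by lra.
- by have := path m.+1; rewrite lee_fin.
Qed.

Lemma dominating_family (hd : (0 < d)%N) : exists FF : set (dyadic d),
  [/\ (forall F, FF F -> cube R F `<=` cube R F0), sparse mu FF &
     forall x, cube R F0 x -> ~ null_cubes mu x ->
       (`|T f x|%:E <= 11%:E * (L1_weakL1_opnorm mu T + 1) * rhs FF x)%E].
Proof.
have N_ge0 := opnorm_ge0.
case E : (L1_weakL1_opnorm mu T) => [r| |].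
- have r0 : 0 <= r by move: N_ge0; rewrite E lee_fin.
  have r1 : 1 <= r + 1 by rewrite lerDr.
  exists (stopping_family mu eps f (r + 1) F0); split.
  + by move=> F fF; case: (stopping_family_sub mu eps f (r + 1) r1 F0 F fF).
  + (* The infimum need not be known to be attained: the extra summand 1 leaves
       room for an admissible constant below r + 1. *)
    have [] : exists2 y, [set c%:E | c in [set c : R | 0 <= c /\ forall g,
        mu.-integrable [set: borelR R d] (EFin \o g) ->
        (weakL1_norm mu (T g) <= c%:E * L1_norm mu g)%E]] y & (y < (r + 1)%:E)%E.
      apply: ereal_inf_lt; move: E; rewrite /L1_weakL1_opnorm => ->.
      by rewrite lte_fin ltrDl.
    move=> _ [c [c0 hT] <-]; rewrite lte_fin => /ltW cr.
    exact: (sparse_stopping_family mu hmu eps heps f fi (r + 1) r1 c).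
  + by rewrite -E => x Fx nx; exact: domination_finite_opnorm.
- exists [set F0]; split; first by move=> F ->.
  + exists 2^-1; split; first by rewrite invr_gt0 ltr0n/= invf_lt1// ltr1n.
    move=> F ->; rewrite esum1 ?mule_ge0// => G [-> [_ nF]].
    by case: nF.
  + by rewrite -E => x Fx nx; exact: domination_infinite_opnorm.
- by move: N_ge0; rewrite E.
Qed.

End domination.

Theorem proposition3p7 (R : realType) :
  exists C : R, 0 < C /\
  forall (d : nat) (hd : (0 < d)%N)
    (mu : {measure set (borelR R d) -> \bar R}) (hmu : locally_finite mu)
    (eps : dyadic d -> R) (heps : forall Q, `|eps Q| <= 1)
    (F0 : dyadic d)
    (f : 'rV[R]_d -> R) (hf : loc_integrable mu f)
    (hsupp : forall x, ~ cube R F0 x -> f x = 0),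
  exists FF : set (dyadic d),
    [/\ (forall F, FF F -> cube R F `<=` cube R F0),
        sparse mu FF &
        {ae mu, forall x : 'rV[R]_d,
          ((`|martingale_transform mu eps f x| * \1_(cube R F0) x)%:E
           <= C%:E * (L1_weakL1_opnorm mu (martingale_transform mu eps) + 1)
              * (\esum_(F in FF)
                   (avg mu (fun y => `|f y|) F * \1_(cube R F) x)%:E
                 + \esum_(F in FF)
                   (avg mu (fun y => `|f y|) (parent F) * \1_(cube R F) x)%:E))%E}].
Proof.
exists 11; split=> // d hd mu hmu eps heps F0 f hf hsupp.
have fi Q : mu.-integrable (cube R Q) (EFin \o f) by exact: loc_integrable_cube.
have [FF [FFsub FFsparse dom]] := dominating_family mu hmu eps heps f fi F0 hsupp hd.
exists FF; split=> //.
apply: (negligibleS _ (null_cubes_negligible mu hmu)) => x /= nle.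
apply: contrapT => nx; apply: nle; rewrite indicE.
have [Fx|nFx] := pselect (cube R F0 x); first by rewrite mem_set// mulr1; exact: dom.
rewrite memNset// mulr0; apply: mule_ge0; last exact: rhs_ge0.
by rewrite mule_ge0// adde_ge0// opnorm_ge0.
Qed.
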